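(* Let $H$ be an abelian group (regarded as carrying the trivial multiplicative Lie algebra structure), let $K$ be a group, let $\sigma : K \to \mathrm{Aut}(H)$, $x \mapsto \sigma_x$, be a group homomorphism, and let $G = H \rtimes_{\sigma} K$. For a multiplicative Lie algebra structure $\star$ on $K$ and maps $\Gamma : K \to \mathrm{End}(H)$, $x\mapsto \Gamma_x$, and $\eta : K \times K \to H$, consider the following conditions, required for all $x,y,z \in K$ and $h,k,l \in H$: 1. $\eta(x,1)=\eta(1,x)=\eta(x,x)=1$; 2. $\Gamma_{xy}(h)=\Gamma_x(h)\,\sigma_x(\Gamma_y(h))$ and $\Gamma_{x\star y}(\sigma_y(h))=\Gamma_x(\Gamma_y(h))\,\Gamma_{xyx^{-1}}(\Gamma_x(h^{-1}))$; 3. $l\,\Gamma_x(l)\,\sigma_{(xy)\star z}\big(h^{-1}l^{-1}\sigma_x(k^{-1})\Gamma_z(h^{-1}\sigma_x(k^{-1}))\big)\,\eta(xy,z) = \sigma_x\big(l\,\sigma_{y\star z}(k^{-1}l^{-1}\Gamma_z(k^{-1}))\,\eta(y,z)\big)\;\sigma_{{}^x(y\star z)}\big(l\,\Gamma_x(l)\,\sigma_{x\star z}(h^{-1}l^{-1}\Gamma_z(h^{-1}))\,\eta(x,z)\big)$; 4. $\sigma_y(l)\,\Gamma_x(\sigma_y(l))\,\sigma_{x\star(yz)}\big(h^{-1}\sigma_y(l^{-1})\Gamma_{yz}(h^{-1})\big)\,\eta(x,yz) = \sigma_{x\star y}(h^{-1}\Gamma_y(h^{-1}))\,\eta(x,y)\;\sigma_{(x\star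 y)y}\big(h\,l\,\Gamma_x(l)\,\sigma_{x\star z}(h^{-1}l^{-1}\Gamma_z(h^{-1}))\,\eta(x,z)\big)$; 5. $A\cdot \sigma_{(x\star y)\star {}^yz}(B)\cdot \sigma_{((x\star y)\star {}^yz)((y\star z)\star {}^zx)}(C) = 1$, where $$\begin{aligned} A ={}& hk^2\,\Gamma_x(k)\,\sigma_y(l)\,\sigma_{{}^yz}(k^{-1})\,\eta(x,y)\,\Gamma_{x\star y}\big(k\,\sigma_y(l)\,\sigma_{{}^yz}(k^{-1})\big)\,\sigma_{x\star y}\big(h^{-1}k^{-1}\Gamma_y(h^{-1})\big)\\ &\cdot \sigma_{(x\star y)\star {}^yz}\Big(h^{-1}k^{-2}\,\Gamma_x(k)^{-1}\sigma_{x\star y}(hk\Gamma_y(h))\,\eta(x,y)^{-1}\sigma_y(l^{-1})\,\sigma_{{}^yz}(k)\\ &\qquad\cdot\Gamma_{{}^yz}\big(h^{-1}k^{-1}\Gamma_x(k)^{-1}\sigma_{x\star y}(hk\Gamma_y(h))\,\eta(x,y)^{-1}\big)\Big)\,\eta(x\star y,{}^yz),\end{aligned}$$ $$\begin{aligned} B ={}& kl^2\,\Gamma_y(l)\,\sigma_z(h)\,\sigma_{{}^zx}(l^{-1})\,\eta(y,z)\,\Gamma_{y\star z}\big(l\,\sigma_z(h)\,\sigma_{{}^zx}(l^{-1})\big)\,\sigma_{y\star z}\big(k^{-1}l^{-1}\Gamma_z(k^{-1})\big)\\ &\cdot \sigma_{(y\star z)\star {}^zx}\Big(k^{-1}l^{-2}\,\Gamma_y(l)^{-1}\sigma_{y\star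 z}(kl\Gamma_z(k))\,\eta(y,z)^{-1}\sigma_z(h^{-1})\,\sigma_{{}^zx}(l)\\ &\qquad\cdot\Gamma_{{}^zx}\big(k^{-1}l^{-1}\Gamma_y(l)^{-1}\sigma_{y\star z}(kl\Gamma_z(k))\,\eta(y,z)^{-1}\big)\Big)\,\eta(y\star z,{}^zx),\end{aligned}$$ $$\begin{aligned} C ={}& lh^2\,\Gamma_z(h)\,\sigma_x(k)\,\sigma_{{}^xy}(h^{-1})\,\eta(z,x)\,\Gamma_{z\star x}\big(h\,\sigma_x(k)\,\sigma_{{}^xy}(h^{-1})\big)\,\sigma_{z\star x}\big(l^{-1}h^{-1}\Gamma_x(l^{-1})\big)\\ &\cdot \sigma_{(z\star x)\star {}^xy}\Big(l^{-1}h^{-2}\,\Gamma_z(h)^{-1}\sigma_{z\star x}(lh\Gamma_x(l))\,\eta(z,x)^{-1}\sigma_x(k^{-1})\,\sigma_{{}^xy}(h)\\ &\qquad\cdot\Gamma_{{}^xy}\big(l^{-1}h^{-1}\Gamma_z(h)^{-1}\sigma_{z\star x}(lh\Gamma_x(l))\,\eta(z,x)^{-1}\big)\Big)\,\eta(z\star x,{}^xy);\end{aligned}$$ 6. $\sigma_z\big(\Gamma_x(k)\,\sigma_{x\star y}(h^{-1}k^{-1}\Gamma_y(h^{-1}))\,\eta(x,y)\big) = l\,\sigma_{{}^zx}(l^{-1})\,\sigma_{{}^zy}(l^{-1})\,\Gamma_{{}^zx}\big(l\,\sigma_z(k)\,\sigma_{{}^zy}(l^{-1})\big)\;\sigma_{{}^z(x\star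 y)}\big(l^{-1}\sigma_z(h^{-1})\sigma_z(k^{-1})\sigma_{{}^zx}(l)\sigma_{{}^zy}(l)\,\Gamma_{{}^zy}(l^{-1}\sigma_z(h^{-1})\sigma_{{}^zx}(l))\big)\,\eta({}^zx,{}^zy)$. (a) If $\star$ is a multiplicative Lie algebra structure on $K$ and $\Gamma : K \to \mathrm{End}(H)$, $\eta: K\times K\to H$ are maps satisfying conditions 1–6, then $$(h,x)\,\tilde{\star}\,(k,y) = \big(hk\,\Gamma_x(k)\,\sigma_{x\star y}(h^{-1}k^{-1}\Gamma_y(h^{-1}))\,\eta(x,y),\; x\star y\big),\qquad (h,x),(k,y)\in G,$$ defines a multiplicative Lie algebra structure $\tilde\star$ on $G$. (b) Conversely, let $\tilde\star$ be a multiplicative Lie algebra structure on $G$ such that $H$ is an ideal of $G$ (with $\tilde\star$ trivial on $H$). Then there exist a multiplicative Lie algebra structure $\star$ on $K$ and maps $\Gamma : K\to \mathrm{End}(H)$ and $\eta : K\times K\to H$ satisfying conditions 1–6 such that $$(h,x)\,\tilde{\star}\,(k,y) = \big(hk\,\Gamma_x(k)\,\sigma_{x\star y}(h^{-1}k^{-1}\Gamma_y(h^{-1}))\,\eta(x,y),\; x\star y\big)\quad\text{for all }(h,x),(k,y)\in G.$$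
   Context: All groups are written multiplicatively and ${}^{a}b = aba^{-1}$. A multiplicative Lie algebra structure on a group $G$ is a binary operation $\star$ on $G$ such that for all $x,y,z\in G$: (i) $x\star x=1$; (ii) $x\star(yz)=(x\star y)\,{}^{y}(x\star z)$; (iii) $(xy)\star z={}^{x}(y\star z)\,(x\star z)$; (iv) $((x\star y)\star{}^{y}z)\,((y\star z)\star{}^{z}x)\,((z\star x)\star{}^{x}y)=1$; (v) ${}^{z}(x\star y)={}^{z}x\star{}^{z}y$. It is trivial if $x\star y=1$ for all $x,y$. An ideal of $(G,\star)$ is a normal subgroup $I$ of $G$ with $a\star g\in I$ for all $a\in I$, $g\in G$. $\mathrm{End}(H)$ is the set of group endomorphisms of $H$ and $\mathrm{Aut}(H)$ the group of automorphisms. $H\rtimes_\sigma K$ is the set $H\times K$ with operation $(h,x)(k,y)=(h\,\sigma_x(k),xy)$; $H$ is identified with the subgroup $H\times\{1\}$. *)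

(* Defs.v *)
From HB Require Import structures.
From mathcomp Require Import all_boot.

Set Implicit Arguments.
Unset Strict Implicit.
Unset Printing Implicit Defensive.

Local Open Scope group_scope.

(* Conjugation on the left, unlike [x ^ y := y^-1 * x * y] of the library. *)
Definition lconjg (G : groupType) (a b : G) : G := a * b * a^-1.
Notation "a |> b" := (lconjg a b) (at level 35, right associativity) : group_scope.

(* For groups, the field [gmulf1] of the library structure follows from
   multiplicativity, so these are exactly the group endomorphisms. *)
Notation End H := (UMagmaMorphism.type H H).

Record mlie_structure (G : groupType) (star : G -> G -> G) : Prop := MLie {
  mlie_self : forall x, star x x = 1;
  mlie_mulr : forall x y z, star x (y * z) = star x y * (y |> star x z);
  mlie_mull : forall x y z, star (x * y) z = (x |> star y z) * star x z;
  mlie_jacobi : forall x y z,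
    star (star x y) (y |> z) * star (star y z) (z |> x)
      * star (star z x) (x |> y) = 1;
  mlie_conj : forall x y z, z |> star x y = star (z |> x) (z |> y)
}.

Record mlie_ideal (G : groupType) (star : G -> G -> G) (I : {pred G}) : Prop :=
  MLieIdeal {
    mlie_ideal_subgroup : group_closed I;
    mlie_ideal_normal : forall g a, a \in I -> g |> a \in I;
    mlie_ideal_star : forall a g, a \in I -> star a g \in I
  }.

Definition mlie_trivial_on (G : groupType) (star : G -> G -> G) (I : {pred G}) :
    Prop :=
  {in I &, forall a b, star a b = 1}.

Record Aut (H : groupType) := MkAut {
  aut_end :> End H;
  aut_bij : bijective aut_end
}.

(* The product of Aut(H) is composition, evaluated pointwise here. *)
Record homAut (K H : groupType) := HomAut {
  hom_aut :> K -> Aut H;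
  hom_autM : forall x y h, hom_aut (x * y) h = hom_aut x (hom_aut y h)
}.

(* A separate name for [H * K], because the library equips the pair type itself
   with the direct product structure. *)
Definition semidirect (K H : groupType) (sigma : homAut K H) : Type :=
  (H * K)%type.

Section Semidirect.
Variables (K H : groupType) (sigma : homAut K H).
Local Notation G := (semidirect sigma).

Definition semidirect_one : G := (1, 1).
Definition semidirect_mul (p q : G) : G := (p.1 * sigma p.2 q.1, p.2 * q.2).
Definition semidirect_inv (p : G) : G := (sigma p.2^-1 p.1^-1, p.2^-1).

Lemma homAut1 (h : H) : sigma 1 h = h.
Proof. by apply: (bij_inj (aut_bij (sigma 1))); rewrite -hom_autM mulg1. Qed.

Lemma semidirect_mulA : associative semidirect_mul.
Proof.
move=> [h x] [k y] [l z].
by rewrite /semidirect_mul /= gmulfM hom_autM !mulgA.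
Qed.

Lemma semidirect_mul1 : left_id semidirect_one semidirect_mul.
Proof. by case=> h x; rewrite /semidirect_mul /= homAut1 !mul1g. Qed.

Lemma semidirect_mulr1 : right_id semidirect_one semidirect_mul.
Proof. by case=> h x; rewrite /semidirect_mul /= gmulf1 !mulg1. Qed.

Lemma semidirect_mulV :
  left_inverse semidirect_one semidirect_inv semidirect_mul.
Proof.
case=> h x.
by rewrite /semidirect_mul /semidirect_inv /= -gmulfM !mulVg gmulf1.
Qed.

Lemma semidirect_mulrV :
  right_inverse semidirect_one semidirect_inv semidirect_mul.
Proof.
case=> h x; rewrite /semidirect_mul /semidirect_inv /= -hom_autM.
by rewrite !mulgV homAut1 mulgV.
Qed.

HB.instance Definition _ := Choice.copy G (H * K)%type.
HB.instance Definition _ := isGroup.Build G semidirect_mulA semidirect_mul1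
  semidirect_mulr1 semidirect_mulV semidirect_mulrV.

(* The subgroup H x {1} of G. *)
Definition semidirect_left : {pred G} := [pred p : G | p.2 == 1].

Variables (star : K -> K -> K) (Gamma : K -> End H) (eta : K -> K -> H).
Local Notation "x ⋆ y" := (star x y) (at level 38, no associativity).

Definition semidirect_star (p q : G) : G :=
  let: (h, x) := p in
  let: (k, y) := q in
  (h * k * Gamma x k
     * sigma (x ⋆ y) (h^-1 * k^-1 * Gamma y h^-1) * eta x y,
   x ⋆ y).

(* The factor A of the Jacobi condition; B and C are its images under the
   cyclic shift (h,x) -> (k,y) -> (l,z) -> (h,x). *)
Definition jacobi_factor (h k l : H) (x y z : K) : H :=
  h * k ^+ 2 * Gamma x k * sigma y l * sigma (y |> z) k^-1 * eta x y
    * Gamma (x ⋆ y) (k * sigma y l * sigma (y |> z) k^-1)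
    * sigma (x ⋆ y) (h^-1 * k^-1 * Gamma y h^-1)
    * sigma ((x ⋆ y) ⋆ (y |> z))
        (h^-1 * k ^- 2 * (Gamma x k)^-1
           * sigma (x ⋆ y) (h * k * Gamma y h) * (eta x y)^-1
           * sigma y l^-1 * sigma (y |> z) k
           * Gamma (y |> z)
               (h^-1 * k^-1 * (Gamma x k)^-1
                  * sigma (x ⋆ y) (h * k * Gamma y h) * (eta x y)^-1))
    * eta (x ⋆ y) (y |> z).

Record extension_conditions : Prop := ExtensionConditions {
  ext_eta1 : forall x, [/\ eta x 1 = 1, eta 1 x = 1 & eta x x = 1];
  ext_GammaM : forall x y h, Gamma (x * y) h = Gamma x h * sigma x (Gamma y h);
  ext_Gamma_star : forall x y h,
    Gamma (x ⋆ y) (sigma y h)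
    = Gamma x (Gamma y h) * Gamma (x * y * x^-1) (Gamma x h^-1);
  ext_mull : forall x y z h k l,
    l * Gamma x l
      * sigma ((x * y) ⋆ z)
          (h^-1 * l^-1 * sigma x k^-1 * Gamma z (h^-1 * sigma x k^-1))
      * eta (x * y) z
    = sigma x (l * sigma (y ⋆ z) (k^-1 * l^-1 * Gamma z k^-1) * eta y z)
      * sigma (x |> (y ⋆ z))
          (l * Gamma x l
             * sigma (x ⋆ z) (h^-1 * l^-1 * Gamma z h^-1) * eta x z);
  ext_mulr : forall x y z h l,
    sigma y l * Gamma x (sigma y l)
      * sigma (x ⋆ (y * z)) (h^-1 * sigma y l^-1 * Gamma (y * z) h^-1)
      * eta x (y * z)
    = sigma (x ⋆ y) (h^-1 * Gamma y h^-1) * eta x y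
      * sigma ((x ⋆ y) * y)
          (h * l * Gamma x l
             * sigma (x ⋆ z) (h^-1 * l^-1 * Gamma z h^-1) * eta x z);
  ext_jacobi : forall x y z h k l,
    jacobi_factor h k l x y z
      * sigma ((x ⋆ y) ⋆ (y |> z)) (jacobi_factor k l h y z x)
      * sigma (((x ⋆ y) ⋆ (y |> z)) * ((y ⋆ z) ⋆ (z |> x)))
          (jacobi_factor l h k z x y)
    = 1;
  ext_conj : forall x y z h k l,
    sigma z (Gamma x k * sigma (x ⋆ y) (h^-1 * k^-1 * Gamma y h^-1) * eta x y)
    = l * sigma (z |> x) l^-1 * sigma (z |> y) l^-1
      * Gamma (z |> x) (l * sigma z k * sigma (z |> y) l^-1)
      * sigma (z |> (x ⋆ y))
          (l^-1 * sigma z h^-1 * sigma z k^-1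
             * sigma (z |> x) l * sigma (z |> y) l
             * Gamma (z |> y) (l^-1 * sigma z h^-1 * sigma (z |> x) l))
      * eta (z |> x) (z |> y)
}.

End Semidirect.

Arguments semidirect_left {K H} sigma.
Arguments semidirect_star {K H} sigma star Gamma eta p q.
Arguments extension_conditions {K H} sigma star Gamma eta.

(* Main.v *)
From HB Require Import structures.
Require Import Defs.
From mathcomp Require Import all_boot.

Set Implicit Arguments.
Unset Strict Implicit.
Unset Printing Implicit Defensive.

Local Open Scope group_scope.

(** The first coordinate of a product, a left conjugate or a value of the
    operation in [H ><| K] is an explicit product, in the abelian group [H], of
    values of [sigma], [Gamma] and [eta]; the second coordinate is the same
    expression in [K].  Each multiplicative Lie axiom in [H ><| K] therefore
    splits into the same axiom in [K] and an identity in [H].  The identities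
    for the two additivity laws, Jacobi, conjugation and [star p p = 1] are, once
    the factors common to both sides are cancelled, conditions that define
    [extension_conditions]; left additivity also uses the cocycle rule for
    [Gamma (x * y)].  This is proved as equivalences ([star_self_iff],
    [star_mulr_iff], [star_mull_iff], [star_jacobi_iff], [star_conj_iff]), so
    both directions of the theorem rest on the same five computations.

    From the conditions to the structure, nothing else is needed.  Conversely,
    the conditions that are not such a translation come from special arguments:
    [eta x 1 = eta 1 x = 1] since bracketing with the unit gives the unit, the
    cocycle rule from left additivity with last argument in [H], and the rule for
    [Gamma (star x y)] from the Jacobi identity at [(1, x), (1, y), (h, 1)].

    It remains to see that every structure for which [H] is an ideal has the
    prescribed form ([ideal_starE]).  Its values on the complement [{1} x K]
    give [eta] and the operation on [K], and its values on pairs from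
    [{1} x K] and [H] give [Gamma], which takes values in [H] because [H] is an
    ideal.  As [(h, x) = (h, 1) (1, x)], the two additivity laws reduce any
    value to these and to values on [H], which are trivial. *)

(** * Deciding identities in abelian groups *)

Inductive word := Atom of nat | One | Mul of word & word | Inv of word.

(** The flag tracks the parity of the inversions passed on the way down, so that
    a word is the product of [atoms true] over that of [atoms false]. *)
Fixpoint atoms (positive : bool) (w : word) : seq nat :=
  match w with
  | Atom i => if positive then [:: i] else [::]
  | One => [::]
  | Mul u v => atoms positive u ++ atoms positive v
  | Inv u => atoms (~~ positive) u
  end.

Section AbelianWords.
Variable H : groupType.

Fixpoint eval (env : seq H) (w : word) : H :=
  match w with
  | Atom i => nth 1 env i
  | One => 1
  | Mul u v => eval env u * eval env v
  | Inv u => (eval env u)^-1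
  end.

Variables (H_abelian : forall a b : H, commute a b) (env : seq H).

Local Notation prod s := (\prod_(i <- s) nth 1 env i).

Lemma prod_perm s t : perm_eq s t -> prod s = prod t.
Proof.
move=> st; pose P u := prod u = prod t; change (P s).
rewrite perm_sym in st; apply: (catCA_perm_ind _ st) => // s1 s2 s3.
by rewrite /P !big_cat /= !mulgA (H_abelian (prod s1)).
Qed.

Lemma eval_atoms w : eval env w * prod (atoms false w) = prod (atoms true w).
Proof.
elim: w => [i||u IHu v IHv|u IHu] /=.
- by rewrite big_nil big_seq1 mulg1.
- by rewrite big_nil mulg1.
- rewrite !big_cat /= -IHu -IHv !mulgA; congr (_ * _).
  by rewrite -!mulgA; congr (_ * _); rewrite H_abelian.
- by rewrite -IHu mulKg.
Qed.

(** Moving the inverted letters of each side to the other side turns an equality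
    of words into an equality of two positive monomials, which in an abelian
    group follows from equality of multisets of letters. *)
Lemma eval_perm u v :
  perm_eq (atoms true u ++ atoms false v) (atoms true v ++ atoms false u) ->
  eval env u = eval env v.
Proof.
move/prod_perm; rewrite !big_cat /= -!eval_atoms -!mulgA.
by rewrite (H_abelian (prod (atoms false u))) => /mulIg.
Qed.

(** Two equations are equivalent when they differ by factors common to both
    sides.  In an abelian group the hypothesis says that [a / b] and [a' / b']
    agree, and it is an identity that comparison of letters can decide. *)
Lemma abelian_eq_iff (a b a' b' : H) : a * b' = b * a' -> a = b <-> a' = b'.
Proof.
move=> E; split=> [eq_ab | eq_ab'].
- by apply/esym/(mulgI b); rewrite -E eq_ab.
- by apply/(mulIg b'); rewrite E eq_ab'.
Qed.

End AbelianWords.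

(** Reification: the letters are the maximal subterms that are neither products,
    inverses nor units, compared syntactically.  The images of [sigma] and
    [Gamma] must thus be distributed over products beforehand. *)
Ltac lookup a env :=
  lazymatch env with
  | a :: _ => constr:(0%N)
  | _ :: ?env' => let i := lookup a env' in constr:(i.+1)
  end.

Ltac collect a env :=
  lazymatch a with
  | ?b * ?c => let env' := collect b env in collect c env'
  | ?b^-1 => collect b env
  | 1 => env
  | _ => match env with
         | _ => let i := lookup a env in env
         | _ => constr:(a :: env)
         end
  end.

Ltac reify a env :=
  lazymatch a with
  | ?b * ?c => let u := reify b env in let v := reify c env in constr:(Mul u v)
  | ?b^-1 => let u := reify b env in constr:(Inv u)
  | 1 => constr:(One)
  | _ => let i := lookup a env in constr:(Atom i)
  end.

Ltac abelian comm :=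
  match goal with |- @eq ?T ?a ?b =>
    let env := collect a (@nil T) in
    let env := collect b env in
    let u := reify a env in
    let v := reify b env in
    exact: (@eval_perm _ comm env u v)
  end.

(** * The axioms, coordinate by coordinate *)

Section SemidirectStar.
Variables (K H : groupType) (sigma : homAut K H).
Hypothesis H_abelian : forall a b : H, commute a b.
Variables (star : K -> K -> K) (Gamma : K -> End H) (eta : K -> K -> H).
Local Notation G := (semidirect sigma).
Local Notation tstar := (semidirect_star sigma star Gamma eta).
Local Notation "x ⋆ y" := (star x y) (at level 38, no associativity).

Lemma semidirectM (h k : H) (x y : K) :
  ((h, x) : G) * ((k, y) : G) = (h * sigma x k, x * y).
Proof. by []. Qed.

Lemma semidirect_lconjg (h k : H) (x y : K) :
  ((k, y) : G) |> ((h, x) : G) =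
  (k * sigma y h * (sigma (y |> x) k)^-1, y |> x).
Proof.
rewrite [LHS]semidirectM /=; congr (_, _).
by rewrite -hom_autM gmulfV.
Qed.

Lemma pair_eq_iff (a b a' b' : H) (x y : K) :
  x = y -> a * b' = b * a' -> ((a, x) : G) = (b, y) <-> a' = b'.
Proof.
move=> -> E; apply: iff_trans (abelian_eq_iff E).
by split=> [[] | ->].
Qed.

(** After this, [sigma] and [Gamma] are only applied to letters, successive
    [sigma]s are merged, and their indices are left-associated products without
    conjugations, so that equal letters become syntactically equal. *)
Ltac distribute_morphisms :=
  rewrite ?expg2 !(gmulfM, gmulfV) /= -?hom_autM /lconjg ?mulgA ?mulgVK.

Hypothesis starK : mlie_structure star.

Lemma star_self_iff (x : K) (h : H) :
  tstar (h, x) (h, x) = 1 <-> eta x x = 1.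
Proof.
apply: pair_eq_iff; rewrite (mlie_self starK) // !homAut1; distribute_morphisms.
abelian H_abelian.
Qed.

Lemma star_mulr_iff (x y z : K) (h k l : H) :
  tstar (h, x) (((k, y) : G) * (l, z))
    = tstar (h, x) (k, y) * (((k, y) : G) |> tstar (h, x) (l, z)) <->
  sigma y l * Gamma x (sigma y l)
      * sigma (x ⋆ (y * z)) (h^-1 * sigma y l^-1 * Gamma (y * z) h^-1)
      * eta x (y * z)
    = sigma (x ⋆ y) (h^-1 * Gamma y h^-1) * eta x y
      * sigma ((x ⋆ y) * y)
          (h * l * Gamma x l
             * sigma (x ⋆ z) (h^-1 * l^-1 * Gamma z h^-1) * eta x z).
Proof.
rewrite semidirect_lconjg !semidirectM.
apply: pair_eq_iff; rewrite (mlie_mulr starK) //; distribute_morphisms.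
abelian H_abelian.
Qed.

(** The condition has [Gamma x l] where the bracket has [Gamma (x * y) l]: the
    cocycle rule splits off [sigma x (Gamma y l)], which also occurs in the first
    factor of the expanded right-hand side. *)
Lemma star_mull_iff (x y z : K) (h k l : H) :
  (forall g, Gamma (x * y) g = Gamma x g * sigma x (Gamma y g)) ->
  tstar (((h, x) : G) * (k, y)) (l, z)
    = (((h, x) : G) |> tstar (k, y) (l, z)) * tstar (h, x) (l, z) <->
  l * Gamma x l
      * sigma ((x * y) ⋆ z)
          (h^-1 * l^-1 * sigma x k^-1 * Gamma z (h^-1 * sigma x k^-1))
      * eta (x * y) z
    = sigma x (l * sigma (y ⋆ z) (k^-1 * l^-1 * Gamma z k^-1) * eta y z)
      * sigma (x |> (y ⋆ z))
          (l * Gamma x l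
             * sigma (x ⋆ z) (h^-1 * l^-1 * Gamma z h^-1) * eta x z).
Proof.
move=> GammaM; rewrite semidirect_lconjg !semidirectM.
apply: pair_eq_iff; rewrite (mlie_mull starK) // GammaM; distribute_morphisms.
abelian H_abelian.
Qed.

Lemma star_jacobi_factor (x y z : K) (h k l : H) :
  tstar (tstar (h, x) (k, y)) (((k, y) : G) |> (l, z))
  = (jacobi_factor sigma star Gamma eta h k l x y z, (x ⋆ y) ⋆ (y |> z)).
Proof.
rewrite semidirect_lconjg; congr (_, _); rewrite /jacobi_factor.
distribute_morphisms; abelian H_abelian.
Qed.

Lemma star_jacobi_iff (x y z : K) (h k l : H) :
  tstar (tstar (h, x) (k, y)) (((k, y) : G) |> (l, z))
    * tstar (tstar (k, y) (l, z)) (((l, z) : G) |> (h, x))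
    * tstar (tstar (l, z) (h, x)) (((h, x) : G) |> (k, y)) = 1 <->
  jacobi_factor sigma star Gamma eta h k l x y z
    * sigma ((x ⋆ y) ⋆ (y |> z))
        (jacobi_factor sigma star Gamma eta k l h y z x)
    * sigma (((x ⋆ y) ⋆ (y |> z)) * ((y ⋆ z) ⋆ (z |> x)))
        (jacobi_factor sigma star Gamma eta l h k z x y)
  = 1.
Proof.
rewrite !star_jacobi_factor !semidirectM.
by apply: pair_eq_iff; [exact: mlie_jacobi | rewrite mulg1 mul1g].
Qed.

Lemma star_conj_iff (x y z : K) (h k l : H) :
  ((l, z) : G) |> tstar (h, x) (k, y)
    = tstar (((l, z) : G) |> (h, x)) (((l, z) : G) |> (k, y)) <->
  sigma z (Gamma x k * sigma (x ⋆ y) (h^-1 * k^-1 * Gamma y h^-1) * eta x y)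
    = l * sigma (z |> x) l^-1 * sigma (z |> y) l^-1
      * Gamma (z |> x) (l * sigma z k * sigma (z |> y) l^-1)
      * sigma (z |> (x ⋆ y))
          (l^-1 * sigma z h^-1 * sigma z k^-1
             * sigma (z |> x) l * sigma (z |> y) l
             * Gamma (z |> y) (l^-1 * sigma z h^-1 * sigma (z |> x) l))
      * eta (z |> x) (z |> y).
Proof.
rewrite !semidirect_lconjg.
apply: pair_eq_iff; rewrite -(mlie_conj starK) //; distribute_morphisms.
abelian H_abelian.
Qed.

End SemidirectStar.

(** * Consequences of the axioms in any group *)

Section MlieTheory.
Variables (G : groupType) (star : G -> G -> G).
Hypothesis starG : mlie_structure star.

Lemma lconjg1 (a : G) : a |> 1 = 1.
Proof. by rewrite /lconjg mulg1 mulgV. Qed.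

Lemma lconj1g (a : G) : 1 |> a = a.
Proof. by rewrite /lconjg invg1 mulg1 mul1g. Qed.

Lemma mlie_star1r x : star x 1 = 1.
Proof.
apply: (mulgI (star x 1)).
by rewrite -{2}(lconj1g (star x 1)) -(mlie_mulr starG) !mulg1.
Qed.

Lemma mlie_star1l x : star 1 x = 1.
Proof.
apply: (mulIg (star 1 x)).
by rewrite -{1}(lconj1g (star 1 x)) -(mlie_mull starG) !mul1g.
Qed.

(** Expanding [(x * y) star (x * y) = 1] leaves, up to conjugation, the product
    of the two mixed terms. *)
Lemma mlie_anti x y : star y x = (star x y)^-1.
Proof.
have := mlie_self starG (x * y).
rewrite (mlie_mull starG) !(mlie_mulr starG) !(mlie_self starG) lconjg1 mulg1.
rewrite mul1g /lconjg !mulgA mulgVK => /(congr1 (fun g => x^-1 * (g * x))).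
by rewrite mul1g mulgVK mulVg -mulgA mulKg => /mulg1_eq <-; rewrite invgK.
Qed.

Lemma eq_mlie_structure (star' : G -> G -> G) :
  star =2 star' -> mlie_structure star'.
Proof.
case: starG => ss sr sl sj sc e.
by split=> *; rewrite -!e // ?sr ?sl ?sj ?sc.
Qed.

End MlieTheory.

Section MorphEnd.
Variables (H : groupType) (f : H -> H) (fM : {morph f : a b / a * b}).

Lemma morph_fix1 : f 1 = 1.
Proof. by apply: (mulgI (f 1)); rewrite -fM !mulg1. Qed.

Definition morph_End : End H :=
  HB.pack f (isMultiplicative.Build H H f fM)
    (Multiplicative_isUMagmaMorphism.Build H H f morph_fix1).

End MorphEnd.

(** * Structures of the prescribed form and the conditions *)

Section Extension.
Variables (K H : groupType) (sigma : homAut K H).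
Hypothesis H_abelian : forall a b : H, commute a b.
Variables (star : K -> K -> K) (Gamma : K -> End H) (eta : K -> K -> H).
Local Notation G := (semidirect sigma).
Local Notation tstar := (semidirect_star sigma star Gamma eta).
Local Notation "x ⋆ y" := (star x y) (at level 38, no associativity).

Lemma semidirect_star_mlie :
  mlie_structure star -> extension_conditions sigma star Gamma eta ->
  mlie_structure tstar.
Proof.
move=> starK [eta1 GammaM _ mull mulr jac conj].
split=> [[h x]|[h x] [k y] [l z]|[h x] [k y] [l z]|[h x] [k y] [l z]|
         [h x] [k y] [l z]].
- by apply/star_self_iff => //; case: (eta1 x).
- exact/star_mulr_iff.
- exact/star_mull_iff.
- exact/star_jacobi_iff.
- exact/star_conj_iff.
Qed.

Section Conditions.
Hypothesis tstarG : mlie_structure tstar.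

Lemma mlie_quotient : mlie_structure star.
Proof.
pose q (p : G) := p.2; pose s x : G := (1, x).
split=> [x|x y z|x y z|x y z|x y z].
- exact: (congr1 q (mlie_self tstarG (s x))).
- exact: (congr1 q (mlie_mulr tstarG (s x) (s y) (s z))).
- exact: (congr1 q (mlie_mull tstarG (s x) (s y) (s z))).
- exact: (congr1 q (mlie_jacobi tstarG (s x) (s y) (s z))).
- exact: (congr1 q (mlie_conj tstarG (s x) (s y) (s z))).
Qed.

Let starK := mlie_quotient.

Lemma star_lift x y : tstar (1, x) (1, y) = (eta x y, x ⋆ y).
Proof. by rewrite /= invg1 !(gmulf1, mulg1, mul1g). Qed.

Lemma eta_normalized x : [/\ eta x 1 = 1, eta 1 x = 1 & eta x x = 1].
Proof.
split.
- by have := mlie_star1r tstarG (1, x); rewrite star_lift => -[].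
- by have := mlie_star1l tstarG (1, x); rewrite star_lift => -[].
- by have := mlie_self tstarG (1, x); rewrite star_lift => -[].
Qed.

(** This is [1 star (h, 1) = 1]: the first coordinate of the left-hand side is
    [h * Gamma 1 h * h^-1]. *)
Lemma Gamma1 h : Gamma 1 h = 1.
Proof.
have [eta1 _ _] := eta_normalized 1.
have := mlie_star1l tstarG (h, 1); case=> + _.
rewrite eta1 (mlie_self starK) homAut1 invg1 !(gmulf1, mulg1, mul1g).
by rewrite -mulgA H_abelian mulgVK.
Qed.

Lemma star_on_leftr h x k : tstar (h, x) (k, 1) = (Gamma x k, 1).
Proof.
have [eta1 _ _] := eta_normalized x.
rewrite /= (mlie_star1r starK) homAut1 Gamma1 eta1 !mulg1.
by congr (_, _); abelian H_abelian.
Qed.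

Lemma star_on_leftl h x k : tstar (k, 1) (h, x) = ((Gamma x k)^-1, 1).
Proof.
rewrite (mlie_anti tstarG (h, x)) star_on_leftr.
by congr (_, _); rewrite /= invg1 // homAut1.
Qed.

(** Left additivity with third argument in [H], where each bracket is a value of
    [Gamma]. *)
Lemma Gamma_mul x y h : Gamma (x * y) h = Gamma x h * sigma x (Gamma y h).
Proof.
have := mlie_mull tstarG (1, x) (1, y) (h, 1).
rewrite semidirectM !star_on_leftr semidirect_lconjg semidirectM.
case=> -> _; rewrite lconjg1 !homAut1 mul1g invg1 mulg1.
exact: H_abelian.
Qed.

(** The Jacobi identity at [(1, x)], [(1, y)], [(h, 1)]: the arguments of each
    outer bracket include an element of [H], so each is a value of [Gamma]. *)
Lemma Gamma_star x y h :
  Gamma (x ⋆ y) (sigma y h)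
  = Gamma x (Gamma y h) * Gamma (x * y * x^-1) (Gamma x h^-1).
Proof.
have := mlie_jacobi tstarG (1, x) (1, y) (h, 1).
rewrite star_lift star_on_leftl star_on_leftr !semidirect_lconjg.
rewrite lconjg1 lconj1g star_on_leftr !star_on_leftl !semidirectM.
rewrite /= !mulg1 !homAut1 invg1 mul1g mulg1 !gmulfV invgK => -[E].
by apply: (iffRL (abelian_eq_iff _) E); rewrite /lconjg; abelian H_abelian.
Qed.

Lemma mlie_extension_conditions : extension_conditions sigma star Gamma eta.
Proof.
split.
- exact: eta_normalized.
- exact: Gamma_mul.
- exact: Gamma_star.
- move=> x y z h k l; apply/star_mull_iff => //; first exact: Gamma_mul.
  exact: mlie_mull.
(* The component in [H] of the middle argument cancels from right additivity, so
   the condition is obtained at any value of it, here 1. *)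
- move=> x y z h l; apply/(star_mulr_iff _ _ _ _ _ _ _ _ _ 1) => //.
  exact: mlie_mulr.
- by move=> x y z h k l; apply/star_jacobi_iff => //; apply: mlie_jacobi.
- by move=> x y z h k l; apply/star_conj_iff => //; apply: mlie_conj.
Qed.

End Conditions.
End Extension.

(** * Structures in which the normal factor is an ideal *)

Section Ideal.
Variables (K H : groupType) (sigma : homAut K H).
Hypothesis H_abelian : forall a b : H, commute a b.
Local Notation G := (semidirect sigma).
Variable tstar : G -> G -> G.
Hypothesis tstarG : mlie_structure tstar.
Hypothesis idealH : mlie_ideal tstar (semidirect_left sigma).
Hypothesis trivialH : mlie_trivial_on tstar (semidirect_left sigma).

Definition ideal_star (x y : K) : K := (tstar (1, x) (1, y)).2.
Definition ideal_eta (x y : K) : H := (tstar (1, x) (1, y)).1.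
Definition ideal_action (x : K) (k : H) : H := (tstar (1, x) (k, 1)).1.

Lemma mem_left (h : H) : ((h, 1) : G) \in semidirect_left sigma.
Proof. exact: eqxx. Qed.

(** The ideal property speaks of brackets whose left argument is in the ideal;
    antisymmetry transfers it to the right argument. *)
Lemma ideal_actionE x k : tstar (1, x) (k, 1) = (ideal_action x k, 1).
Proof.
have : tstar (k, 1) (1, x) \in semidirect_left sigma.
  by apply: (mlie_ideal_star idealH); apply: mem_left.
rewrite (mlie_anti tstarG (1, x)) /ideal_action.
case: (tstar _ _) => a b /eqP /= e.
by congr (_, _); apply: invg_inj; rewrite e invg1.
Qed.

Lemma ideal_actionM x : {morph ideal_action x : a b / a * b}.
Proof.
move=> a b; have := mlie_mulr tstarG (1, x) (a, 1) (b, 1).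
rewrite semidirectM homAut1 mulg1 !ideal_actionE semidirect_lconjg semidirectM.
case=> -> _; rewrite lconjg1 !homAut1; abelian H_abelian.
Qed.

Definition ideal_Gamma (x : K) : End H := morph_End (ideal_actionM x).

Lemma ideal_GammaE x k : tstar (1, x) (k, 1) = (ideal_Gamma x k, 1).
Proof. exact: ideal_actionE. Qed.

(** Expansion of [(h, 1) (1, x)] against [(k, 1) (1, y)] by additivity: the four
    terms give [1] on [H], [Gamma x k], [Gamma y h^-1] and [eta x y], and the
    conjugations by [h] and [k] supply the remaining factors. *)
Lemma ideal_starE (p q : G) :
  tstar p q = semidirect_star sigma ideal_star ideal_Gamma ideal_eta p q.
Proof.
case: p q => [h x] [k y].
have factor h' x' : (h', x') = ((h', 1) : G) * (1, x').
  by rewrite semidirectM gmulf1 mulg1 mul1g.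
have star_xk : tstar (h, x) (k, 1) = (ideal_Gamma x k, 1).
  rewrite factor (mlie_mull tstarG) ideal_GammaE trivialH ?mem_left // mulg1.
  rewrite semidirect_lconjg lconjg1 !homAut1.
  by congr (_, _); abelian H_abelian.
have star_hy : tstar (h, 1) (1, y) = (ideal_Gamma y h^-1, 1).
  rewrite (mlie_anti tstarG (1, y)) ideal_GammaE.
  congr (_, _); rewrite /= invg1 // homAut1.
  exact/esym/(gmulfV (ideal_Gamma y)).
rewrite [in LHS](factor k) (mlie_mulr tstarG) star_xk.
rewrite [in LHS](factor h) (mlie_mull tstarG) star_hy.
rewrite [tstar (1, x) (1, y)]surjective_pairing !semidirect_lconjg !semidirectM.
rewrite /= !mulg1 !lconj1g mul1g !homAut1.
rewrite -/(ideal_star x y) -/(ideal_eta x y).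
congr (_, _); rewrite !gmulfM !gmulfV /=; abelian H_abelian.
Qed.

End Ideal.

Theorem theorem2p4 (H K : groupType) (H_abelian : forall a b : H, commute a b)
    (sigma : homAut K H) :
  (forall (star : K -> K -> K) (Gamma : K -> End H) (eta : K -> K -> H),
      mlie_structure star ->
      extension_conditions sigma star Gamma eta ->
      mlie_structure (semidirect_star sigma star Gamma eta))
  /\
  (forall tstar : semidirect sigma -> semidirect sigma -> semidirect sigma,
      mlie_structure tstar ->
      mlie_ideal tstar (semidirect_left sigma) ->
      mlie_trivial_on tstar (semidirect_left sigma) ->
      exists (star : K -> K -> K) (Gamma : K -> End H) (eta : K -> K -> H),
        [/\ mlie_structure star,
            extension_conditions sigma star Gamma eta
          & forall (h k : H) (x y : K),
              tstar (h, x) (k, y)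
              = semidirect_star sigma star Gamma eta (h, x) (k, y)]).
Proof.
split=> [star Gamma eta|tstar tstarG idealH trivialH].
  exact: semidirect_star_mlie.
have tstarE := ideal_starE H_abelian tstarG idealH trivialH.
have sdG := eq_mlie_structure tstarG tstarE.
exists (ideal_star tstar), (ideal_Gamma H_abelian tstarG idealH),
  (ideal_eta tstar).
split=> [||h k x y]; first exact: mlie_quotient sdG.
- exact: mlie_extension_conditions sdG.
- exact: tstarE.
Qed.
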